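(* Let $\beta\ge \tfrac12$ and $R>0$, and fix any distribution of the censoring pair $(L,U)$ with $\mathbb P(L\neq U)=1$. Then there is a constant $c>0$ depending only on $\beta$ and $R$ such that \[ \liminf_{n\to\infty}\ \inf_{\hat f}\ \sup_{f\in W(\beta,R)}\ \mathbb E_f\!\left(n^{\frac{2\beta}{2\beta+1}}\,\|\hat f-f\|_2^2\right)\ \ge\ c, \] where the supremum is over probability densities $f$ on $\mathbb S^1$ belonging to $W(\beta,R)$, $\mathbb E_f$ denotes expectation when $X$ has density $f$, and the infimum is over all estimators $\hat f$, i.e. all measurable functions of the observed sample $(X_1',L_1,U_1),\dots,(X_n',L_n,U_n)$.
   Context: Circle convention: $\mathbb S^1$ is identified with $[0,2\pi)$ (angles taken mod $2\pi$) with anticlockwise orientation. For $x,y\in\mathbb S^1$, the circular interval $[x,y]$ is the set of points met going anticlockwise from $x$ to $y$: it is the usual interval if $x\le y$ and $[x,2\pi)\cup[0,y]$ if $x>y$. Censoring model: $X$ is an $\mathbb S^1$-valued random variable with density $f$ (w.r.t. Lebesgue measure on $[0,2\pi)$); $(L,U)$ is a random pair in $(\mathbb S^1)^2$, independent of $X$, with $L\ne U$ a.s. The triplets $(X_i,L_i,U_i)$, $i=1,\dots,n$, are i.i.d. copies of $(X,L,U)$. Set $\Delta_i=\mathbf 1\{X_i\in[L_i,U_i]\}$ and $X_i'=X_i$ if $\Delta_i=1$, $X_i'=-\pi$ otherwise. The observations are $(X_i',L_i,U_i)_{1\le i\le n}$. $\|g\|_2^2=\int_0^{2\pi}g(x)^2dx$,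 $\langle g,h\rangle_2=\int_0^{2\pi}gh$. Trigonometric basis of $\mathbb L^2(\mathbb S^1)$: $\varphi_0=1/\sqrt{2\pi}$, and for $j\ge1$, $\varphi_{2j-1}=\pi^{-1/2}\cos(j\cdot)$, $\varphi_{2j}=\pi^{-1/2}\sin(j\cdot)$. Sobolev class: with $\alpha_j=j^\beta$ for even $j$ and $\alpha_j=(j+1)^\beta$ for odd $j$, $W(\beta,R)=\{g\in\mathbb L^2(\mathbb S^1):\ \sum_{j\ge0}\alpha_j^2|\langle g,\varphi_j\rangle_2|^2<R^2/\pi^{2\beta}\}$. *)

(* Defs.v *)
From HB Require Import structures.
From mathcomp Require Import all_boot all_order all_algebra.
From mathcomp Require Import all_classical all_reals all_analysis.
Set Implicit Arguments. Unset Strict Implicit. Unset Printing Implicit Defensive.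
Import Order.TTheory GRing.Theory Num.Theory.
Import numFieldNormedType.Exports.
Local Open Scope classical_set_scope.
Local Open Scope ring_scope.

Section Defs.
Variable R : realType.

Definition circ : set R := `[0, 2 * pi[%classic.

(* Circular interval [l,u] going anticlockwise from l to u. *)
Definition in_circ_itv (x l u : R) : bool :=
  if l <= u then (l <= x) && (x <= u) else (l <= x) || (x <= u).

Definition obs_type := (R * (R * R))%type.

Definition observe (x : R) (lu : R * R) : obs_type :=
  if in_circ_itv x lu.1 lu.2 then (x, lu) else (- pi, lu).

Definition censoring_law (mu : probability (R * R)%type R) : Prop :=
  mu [set lu | circ lu.1 /\ circ lu.2 /\ lu.1 <> lu.2] = 1%E.

(* Expectation of h(X', L, U) for one observation, X with density f (indep. of (L,U) ~ mu). *)
Definition E1 (f : R -> R) (mu : probability (R * R)%type R)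
    (h : obs_type -> \bar R) : \bar R :=
  (\int[mu]_lu (\int[lebesgue_measure]_(x in circ) ((f x)%:E * h (observe x lu))))%E.

(* Expectation over an i.i.d. sample of size n (iterated integral = product law). *)
Fixpoint En (f : R -> R) (mu : probability (R * R)%type R) (n : nat) :
    (n.-tuple obs_type -> \bar R) -> \bar R :=
  match n with
  | 0 => fun g => g [tuple]
  | n'.+1 => fun g => E1 f mu (fun t => En f mu (fun s => g (cons_tuple t s)))
  end.

Definition L2dist2 (g h : R -> R) : \bar R :=
  (\int[lebesgue_measure]_(x in circ) ((g x - h x) ^+ 2)%:E)%E.

(* Probability densities on S^1 that are in L2 (W(beta,R) is a subset of L2). *)
Definition density_L2 (f : R -> R) : Prop :=
  [/\ measurable_fun circ f,
      (forall x, circ x -> 0 <= f x),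
      (\int[lebesgue_measure]_(x in circ) (f x)%:E = 1)%E &
      (\int[lebesgue_measure]_(x in circ) ((f x) ^+ 2)%:E < +oo)%E].

Definition phi (j : nat) (x : R) : R :=
  if j == 0%N then 1 / Num.sqrt (2 * pi)
  else if odd j then cos ((j.+1./2)%:R * x) / Num.sqrt pi
  else sin ((j./2)%:R * x) / Num.sqrt pi.

Definition fcoef (g : R -> R) (j : nat) : R :=
  \int[lebesgue_measure]_(x in circ) (g x * phi j x).

Definition alpha (beta : R) (j : nat) : R :=
  if odd j then (j.+1%:R) `^ beta else (j%:R) `^ beta.

Definition sobolev (beta Rad : R) (g : R -> R) : Prop :=
  measurable_fun circ g /\
  (\int[lebesgue_measure]_(x in circ) ((g x) ^+ 2)%:E < +oo)%E /\
  (\sum_(0 <= j <oo) ((alpha beta j ^+ 2 * fcoef g j ^+ 2)%:E)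
     < (Rad ^+ 2 / pi `^ (2 * beta))%:E)%E.

Definition estimator (n : nat) (fhat : n.-tuple obs_type -> R -> R) : Prop :=
  measurable_fun [set: n.-tuple obs_type * R]%classic
    (fun p : n.-tuple obs_type * R => fhat p.1 p.2).

Definition risk (beta : R) (mu : probability (R * R)%type R) (n : nat)
    (fhat : n.-tuple obs_type -> R -> R) (f : R -> R) : \bar R :=
  En f mu (fun s => ((n%:R `^ (2 * beta / (2 * beta + 1)))%:E * L2dist2 (fhat s) f)%E).

Definition minimax_risk (beta Rad : R) (mu : probability (R * R)%type R) (n : nat)
    : \bar R :=
  ereal_inf [set ereal_sup [set risk beta mu fhat f
                           | f in [set f | density_L2 f /\ sobolev beta Rad f]]
            | fhat in [set fhat : n.-tuple obs_type -> R -> R | estimator fhat]].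

End Defs.

(* Main.v *)
(** Assouad's lemma on a hypercube of trigonometric densities.  For signs
    [e : {ffun 'I_m -> bool}] let [f_e = 1 / (2 pi) + g * sum_(k < m) +-phi_(2k+1)].
    With [g ^ 2 = kappa / n] and [m ~ n ^ (1 / (2 beta + 1))] the Sobolev norm of
    [f_e] stays bounded, and [beta >= 1/2] keeps [g * m] bounded, so that [f_e]
    is at least [1 / (4 pi)].  Flipping one sign changes the law of one
    uncensored variable by a chi-square divergence of order [g ^ 2 = O(1 / n)];
    censoring only discards information, so no test based on [n] censored
    observations recovers that sign, which costs [g ^ 2] in squared [L2]
    distance by Bessel's inequality.  Summing over the [m] signs gives a risk of
    order [m * g ^ 2 ~ n ^ (- 2 beta / (2 beta + 1))], whatever the law of
    [(L, U)]. *)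

Require Import Defs.
From HB Require Import structures.
From mathcomp Require Import all_boot all_order all_algebra.
From mathcomp Require Import all_classical all_reals all_analysis.
From mathcomp Require Import measurable_realfun lra ring.
Import Order.TTheory GRing.Theory Num.Theory.
Import numFieldNormedType.Exports.
Local Open Scope classical_set_scope.
Local Open Scope ring_scope.

(** * Monotonicity and superadditivity of the integral as a lower integral *)

(* The integral of a nonnegative function is the supremum of the integrals of
   the simple functions below it, hence no measurability is needed here. *)
Section lower_integral.
Context d (T : measurableType d) (R : realType).
Variables (mu : {measure set T -> \bar R}) (D : set T).
Implicit Types (F G H : T -> \bar R).
Local Open Scope ereal_scope.
Import HBNNSimple.

Lemma le_integral_ge0r H F : (forall x, D x -> 0 <= F x) ->
  (forall x, D x -> H x <= F x) ->
  \int[mu]_(x in D) H x <= \int[mu]_(x in D) F x.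
Proof.
move=> F0 HF; rewrite integralE.
(* [H] may take negative values: dropping its negative part increases the integral, and [H^\+ <= F]
   on [D] because [F >= 0]. *)
apply: (@le_trans _ _ (\int[mu]_(x in D) H^\+ x)).
  rewrite -[leRHS]sube0 leeB// integral_ge0 //.
rewrite !ge0_integralE//; apply: ereal_sup_le => _ [h hH <-].
exists h => //= x.
apply: (le_trans (hH x)); rewrite /patch; case: ifPn => // /set_mem Dx.
by rewrite funeposE ge_max HF// F0.
Qed.

(** If [h <= F] and [k <= G] are simple, then [h + k] is a simple function below [F + G]. The two
    suprema are taken one after the other by moving finite terms across the inequality, which is why
    [S = +oo] is treated apart. *)
Lemma ge0_integralD_ge F G :
  (forall x, D x -> 0 <= F x) -> (forall x, D x -> 0 <= G x) ->
  \int[mu]_(x in D) F x + \int[mu]_(x in D) G x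
    <= \int[mu]_(x in D) (F x + G x).
Proof.
move=> F0 G0.
have FG0 x : D x -> 0 <= F x + G x by move=> Dx; rewrite adde_ge0 ?F0 ?G0.
set S := \int[mu]_(x in D) (F x + G x).
have GS : \int[mu]_(x in D) G x <= S.
  by apply: le_integral_ge0r => // x Dx; rewrite leeDr ?F0.
have [->|Sy] := eqVneq S +oo; first by rewrite leey.
have Gfin : \int[mu]_(x in D) G x \is a fin_num.
  by rewrite ge0_fin_numE ?integral_ge0// (le_lt_trans GS)// ltey.
rewrite -leeBrDr// [leLHS]ge0_integralE//.
apply: ge_ereal_sup => _ [h hF <-].
have hS : sintegral mu h <= S.
  apply: (@le_trans _ _ (\int[mu]_(x in D) F x)).
    by rewrite ge0_integralE//; apply: ereal_sup_ubound; exists h.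
  by apply: le_integral_ge0r => // x Dx; rewrite leeDl ?G0.
have hfin : sintegral mu h \is a fin_num.
  by rewrite ge0_fin_numE ?sintegral_ge0// (le_lt_trans hS)// ltey.
rewrite leeBrDr// addeC -leeBrDr// ge0_integralE//.
apply: ge_ereal_sup => _ [k kG <-].
rewrite leeBrDr// -sintegralD// /S ge0_integralE//; apply: ereal_sup_ubound.
exists (add_nnsfun k h) => //= x; move: (hF x) (kG x); rewrite /patch.
case: ifPn => _ hx kx; first by rewrite EFinD addeC leeD.
by rewrite EFinD; apply: (le_trans (leeD kx hx)); rewrite adde0.
Qed.

End lower_integral.

(** * Measurability of parametric integrals and of the censoring map *)

Section measurability.
Context (R : realType).
Local Open Scope ereal_scope.

Lemma measurable_circ : measurable (@circ R : set (measurableTypeR R)).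
Proof. exact: measurable_itv. Qed.

(** Tonelli's theorem, applied to [h] extended by zero off the strip [setT * circ]. *)
Lemma measurable_ge0_integral_circ d (T : measurableType d)
    (h : T * R -> \bar R) : measurable_fun setT h -> (forall p, 0 <= h p) ->
  measurable_fun setT
    (fun x => \int[lebesgue_measure]_(y in @circ R) h (x, y)).
Proof.
move=> mh h0.
pose h' := h \_ (setT `*` @circ R).
have mh' : measurable_fun setT h'.
  have mX : measurable ([set: T] `*` @circ R).
    by apply: measurableX => //; exact: measurable_circ.
  exact: (measurable_restrictT h mX).1 (measurable_funTS mh).
have h'0 p : 0 <= h' p by rewrite /h' /patch; case: ifP.
have := measurable_fun_fubini_tonelli_F (m2 := @lebesgue_measure R) h' mh' h'0.
congr measurable_fun; apply/funext => x; rewrite [RHS]integral_mkcond.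
apply: eq_integral => y _; rewrite /h' !patchE; congr (if _ then _ else _).
by apply/idP/idP => /set_mem; [case=> _ ?|move=> ?]; exact/mem_set.
Qed.

(** Makes the Fourier coefficients of an estimator measurable functions of the sample. Positive and
    negative parts are handled by Tonelli, and [fine] is measurable. *)
Lemma measurable_Rintegral_circ d (T : measurableType d) (h : T * R -> R) :
  measurable_fun setT h ->
  measurable_fun setT
    (fun x => \int[lebesgue_measure]_(y in @circ R) h (x, y))%R.
Proof.
move=> mh; have mEh : measurable_fun setT (EFin \o h) by exact/measurable_EFinP.
have mp := measurable_ge0_integral_circ _ _ _ (measurable_funepos mEh)
  (funepos_ge0 (EFin \o h)).
have mn := measurable_ge0_integral_circ _ _ _ (measurable_funeneg mEh)
  (funeneg_ge0 (EFin \o h)).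
have mI : measurable_fun setT
    (fun x => \int[lebesgue_measure]_(y in @circ R) (h (x, y))%:E).
  have := emeasurable_funB mp mn; congr measurable_fun.
  apply/funext => x; rewrite [RHS]integralE.
  by congr (_ - _); apply: eq_integral => y _; rewrite ?funeposE ?funenegE.
by apply: (measurableT_comp _ mI); exact: fine_measurable.
Qed.

Lemma measurable_observe :
  measurable_fun setT (fun p : R * (R * R) => observe p.1 p.2).
Proof.
have m1 : measurable_fun setT (fun p : R * (R * R) => p.1).
  exact: measurable_fst.
have m2 : measurable_fun setT (fun p : R * (R * R) => p.2).
  exact: measurable_snd.
have ml : measurable_fun setT (fun p : R * (R * R) => p.2.1).
  exact: measurableT_comp measurable_fst m2.
have mu : measurable_fun setT (fun p : R * (R * R) => p.2.2).
  exact: measurableT_comp measurable_snd m2.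
apply: measurable_fun_ifT; last 2 first.
- exact: measurable_fun_pair.
- exact: measurable_fun_pair.
apply: measurable_fun_ifT; first exact: measurable_fun_ler.
- by apply: measurable_and; exact: measurable_fun_ler.
- by apply: measurable_or; exact: measurable_fun_ler.
Qed.

End measurability.

(** * Expectation over the censored sample and testing between two densities *)

Section iterated_expectation.
Context (R : realType) (mu : probability (R * R)%type R).
Implicit Types (f : R -> R) (n : nat).
Local Open Scope ereal_scope.

Let density_ge0 f := forall x : R, circ x -> (0 <= f x)%R.

Lemma E1_ge0 f h : density_ge0 f -> (forall t, 0 <= h t) -> 0 <= E1 f mu h.
Proof.
move=> f0 h0; apply: integral_ge0 => lu _; apply: integral_ge0 => x cx.
by rewrite mule_ge0// lee_fin f0.
Qed.

Lemma En_ge0 f n (g : n.-tuple (obs_type R) -> \bar R) :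
  density_ge0 f -> (forall t, 0 <= g t) -> 0 <= En f mu g.
Proof.
move=> f0; elim: n g => [|n IH] g g0 /=; first exact: g0.
by apply: E1_ge0 => // t; apply: IH.
Qed.

Lemma le_E1 f h k : density_ge0 f -> (forall t, 0 <= k t) ->
  (forall t, h t <= k t) -> E1 f mu h <= E1 f mu k.
Proof.
move=> f0 k0 hk.
have fk0 lu x : circ x -> 0 <= (f x)%:E * k (observe x lu).
  by move=> cx; rewrite mule_ge0// lee_fin f0.
apply: le_integral_ge0r => lu _; first by apply: integral_ge0 => x; exact: fk0.
apply: le_integral_ge0r => x cx; first exact: fk0.
by rewrite lee_wpmul2l// lee_fin f0.
Qed.

Lemma le_En f n (g h : n.-tuple (obs_type R) -> \bar R) :
  density_ge0 f -> (forall t, 0 <= h t) -> (forall t, g t <= h t) ->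
  En f mu g <= En f mu h.
Proof.
move=> f0; elim: n g h => [|n IH] g h h0 gh /=; first exact: gh.
apply: le_E1 => // t; first by apply: En_ge0.
by apply: IH.
Qed.

(** Superadditivity of the lower integral, used at both levels of integration. This is the direction
    in which the risk is bounded below by a sum of coordinate risks. *)
Lemma E1D_ge f h k : density_ge0 f ->
  (forall t, 0 <= h t) -> (forall t, 0 <= k t) ->
  E1 f mu h + E1 f mu k <= E1 f mu (fun t => h t + k t).
Proof.
move=> f0 h0 k0.
have fM0 (u : obs_type R -> \bar R) lu x : (forall t, 0 <= u t) -> circ x ->
    0 <= (f x)%:E * u (observe x lu).
  by move=> u0 cx; rewrite mule_ge0// lee_fin f0.
have int0 (u : obs_type R -> \bar R) lu : (forall t, 0 <= u t) ->
    0 <= \int[lebesgue_measure]_(x in @circ R) ((f x)%:E * u (observe x lu)).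
  by move=> u0; apply: integral_ge0 => x; exact: fM0.
apply: le_trans (ge0_integralD_ge _ _ _ _ _ _ _ _ _) _.
- by move=> lu _; exact: (int0 h).
- by move=> lu _; exact: (int0 k).
apply: le_integral_ge0r => lu _.
  by apply: (int0 (fun t => h t + k t)) => t; rewrite adde_ge0.
apply: le_trans (ge0_integralD_ge _ _ _ _ _ _ _ _ _) _.
- by move=> x; exact: (fM0 h).
- by move=> x; exact: (fM0 k).
apply: le_integral_ge0r => x cx.
  by apply: (fM0 (fun t => h t + k t)) => // t; rewrite adde_ge0.
by rewrite ge0_muleDr.
Qed.

Lemma EnD_ge f n (g h : n.-tuple (obs_type R) -> \bar R) : density_ge0 f ->
  (forall t, 0 <= g t) -> (forall t, 0 <= h t) ->
  En f mu g + En f mu h <= En f mu (fun t => g t + h t).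
Proof.
move=> f0; elim: n g h => [//|n IH] g h g0 h0 /=.
apply: le_trans (E1D_ge _ _ _ _ _ _) _ => //; try by move=> t; apply: En_ge0.
apply: le_E1 => // t; last by apply: IH.
by apply: En_ge0 => // u; rewrite adde_ge0.
Qed.

Lemma En_sum_ge f n (I : Type) (r : seq I)
    (g : I -> n.-tuple (obs_type R) -> \bar R) : density_ge0 f ->
  (forall i t, 0 <= g i t) ->
  \sum_(i <- r) En f mu (g i) <= En f mu (fun t => \sum_(i <- r) g i t).
Proof.
move=> f0 g0; elim: r => [|i r IH].
  by rewrite big_nil; apply: En_ge0 => // t; rewrite big_nil.
rewrite big_cons; apply: le_trans (leeD2l _ IH) _.
apply: le_trans (EnD_ge _ _ _ _ _ _ _) _ => // [t|]; first exact: sume_ge0.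
by apply: le_En => // t; [exact: sume_ge0 | rewrite big_cons].
Qed.

(** The censoring pair stays a parameter next to [T], so that the result serves both for the outer
    integral over [mu] and for integrands that depend on the pair themselves. *)
Lemma measurable_E1_inner d (T : measurableType d) f
    (h : T * obs_type R -> \bar R) :
  measurable_fun setT f -> (forall x, (0 <= f x)%R) ->
  measurable_fun setT h -> (forall p, 0 <= h p) ->
  measurable_fun setT (fun p : T * (R * R) =>
    \int[lebesgue_measure]_(y in @circ R)
      ((f y)%:E * h (p.1, observe y p.2))).
Proof.
move=> mf f0 mh h0.
pose H (q : (T * (R * R)) * R) := (f q.2)%:E * h (q.1.1, observe q.2 q.1.2).
have mq1 : measurable_fun setT (fun q : (T * (R * R)) * R => q.1.1).
  exact: measurableT_comp measurable_fst measurable_fst.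
have mq2 : measurable_fun setT (fun q : (T * (R * R)) * R => q.1.2).
  exact: measurableT_comp measurable_snd measurable_fst.
have mq3 : measurable_fun setT (fun q : (T * (R * R)) * R => q.2).
  exact: measurable_snd.
have mo := measurableT_comp (@measurable_observe R)
  (measurable_fun_pair mq3 mq2).
apply: (measurable_ge0_integral_circ _ _ _ H) => [|q].
  apply: emeasurable_funM.
    by apply/measurable_EFinP; exact: measurableT_comp mf mq3.
  exact: measurableT_comp mh (measurable_fun_pair mq1 mo).
by rewrite mule_ge0// lee_fin.
Qed.

Lemma measurable_E1 d (T : measurableType d) f (h : T * obs_type R -> \bar R) :
  measurable_fun setT f -> (forall x, (0 <= f x)%R) ->
  measurable_fun setT h -> (forall p, 0 <= h p) ->
  measurable_fun setT (fun x => E1 f mu (fun t => h (x, t))).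
Proof.
move=> mf f0 mh h0.
apply: (measurable_fun_fubini_tonelli_F (m2 := mu) _
  (measurable_E1_inner _ _ _ _ mf f0 mh h0)) => p.
by apply: integral_ge0 => y _; rewrite mule_ge0// lee_fin.
Qed.

(** The parameter space varies in the induction: each observation that is split off the sample is
    moved into it. *)
Lemma measurable_En d (T : measurableType d) f n
    (g : T * n.-tuple (obs_type R) -> \bar R) :
  measurable_fun setT f -> (forall x, (0 <= f x)%R) ->
  measurable_fun setT g -> (forall p, 0 <= g p) ->
  measurable_fun setT (fun x => En f mu (fun v => g (x, v))).
Proof.
move=> mf f0; elim: n d T g => [|n IH] d T g mg g0 /=.
  exact: measurable_fun_pair1.
apply: (measurable_E1 _ _ _
  (fun p => En f mu (fun v => g (p.1, cons_tuple p.2 v)))) => // [|p].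
  pose G (q : (T * obs_type R) * n.-tuple (obs_type R)) :=
    g (q.1.1, cons_tuple q.1.2 q.2).
  apply: (IH _ _ G) => [|q]; last exact: g0.
  apply: (measurableT_comp mg); apply: measurable_fun_pair.
    exact: measurableT_comp measurable_fst measurable_fst.
  apply: measurable_cons; last exact: measurable_snd.
  exact: measurableT_comp measurable_snd measurable_fst.
by apply: En_ge0.
Qed.

(* The weight [l] stands for the likelihood ratio of the observations that have
   already been integrated out; [min 1 l >= l - l ^ 2 / 4] reduces the testing
   affinity to the first two moments of the ratio. *)
Lemma two_point_testing (f0 f1 : R -> R) (K : R) :
  measurable_fun setT f0 -> measurable_fun setT f1 ->
  (forall x, (0 < f0 x)%R) -> (forall x, (0 <= f1 x)%R) ->
  lebesgue_measure.-integrable (@circ R) (EFin \o f1) ->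
  (\int[lebesgue_measure]_(x in @circ R) f1 x)%R = 1%R ->
  lebesgue_measure.-integrable (@circ R)
    (EFin \o (fun x => f1 x ^+ 2 / f0 x)%R) ->
  (\int[lebesgue_measure]_(x in @circ R) (f1 x ^+ 2 / f0 x) <= K)%R ->
  (0 <= K)%R ->
  forall n (l s : R) (g0 g1 : n.-tuple (obs_type R) -> \bar R),
    (0 <= l)%R -> (0 <= s)%R ->
    measurable_fun setT g0 -> measurable_fun setT g1 ->
    (forall t, 0 <= g0 t) -> (forall t, 0 <= g1 t) ->
    (forall t, s%:E <= g0 t + g1 t) ->
  (s * (l - l ^+ 2 * K ^+ n / 4))%:E <= En f0 mu g0 + l%:E * En f1 mu g1.
Proof.
move=> mf0 mf1 f0_gt0 f1_ge0 intf1 f1E intq qK K0.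
have f0_ge0 x : (0 <= f0 x)%R by exact/ltW.
have mcirc := @measurable_circ R.
elim => [|n IH] l s g0 g1 l0 s0 mg0 mg1 g00 g10 sg.
  rewrite /= expr0 mulr1; set a := g0 _; set b := g1 _.
  have sab : s%:E <= a + b by exact: sg.
  (* In both cases [a + l b >= min(1, l) (a + b)]. For [l <= 1] the square term is dropped; for
     [l >= 1] the inequality [l - l^2 / 4 <= 1] is [(l - 2)^2 >= 0]. *)
  have [l1|/ltW l1] := leP l 1%R.
    apply: (@le_trans _ _ (l%:E * (a + b))).
      apply: (@le_trans _ _ (l%:E * s%:E)); last by rewrite lee_wpmul2l.
      rewrite -EFinM lee_fin; nra.
    rewrite ge0_muleDr; [|exact: g00|exact: g10].
    by apply: leeD => //; rewrite gee_pMl ?g00// ?lee_fin.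
  apply: (@le_trans _ _ s%:E).
    by rewrite lee_fin; have := sqr_ge0 (l - 2); nra.
  apply: (le_trans sab); apply: leeD => //.
  by rewrite -[leLHS]mul1e lee_wpmul2r ?lee_fin ?g10.
rewrite /=; set A := fun t => En f0 mu _; set B := fun t => En f1 mu _.
have A0 t : 0 <= A t by apply: En_ge0.
have B0 t : 0 <= B t by apply: En_ge0.
have mcons t : measurable_fun setT
    (fun v : n.-tuple (obs_type R) => cons_tuple t v).
  by apply: measurable_cons => //; exact: measurable_id.
have mEn (f : R -> R) (g : n.+1.-tuple (obs_type R) -> \bar R) :
    measurable_fun setT f -> (forall x, (0 <= f x)%R) ->
    measurable_fun setT g -> (forall v, 0 <= g v) ->
    measurable_fun setT (fun p : (R * R) * obs_type R =>
      En f mu (fun v => g (cons_tuple p.2 v))).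
  move=> mf f_ge0 mg g_ge0.
  pose G (q : ((R * R) * obs_type R) * n.-tuple (obs_type R)) :=
    g (cons_tuple q.1.2 q.2).
  apply: (measurable_En _ _ _ _ G) => // [|q]; last exact: g_ge0.
  apply: (measurableT_comp mg); apply: measurable_cons.
    exact: measurableT_comp measurable_snd measurable_fst.
  exact: measurable_snd.
have mA := mEn _ _ mf0 f0_ge0 mg0 g00.
have mB := mEn _ _ mf1 f1_ge0 mg1 g10.
have mx (f : R -> R) (h : (R * R) * obs_type R -> \bar R) lu :
    measurable_fun setT f -> measurable_fun setT h ->
    measurable_fun (@circ R) (fun x => (f x)%:E * h (lu, observe x lu)).
  move=> mf mh; apply: measurable_funTS; apply: emeasurable_funM.
    exact/measurable_EFinP.
  apply: (measurableT_comp mh); apply: measurable_fun_pair => //.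
  have := measurable_fun_pair1 lu (@measurable_observe R); exact.
have mlu (f : R -> R) (h : (R * R) * obs_type R -> \bar R) :
    measurable_fun setT f -> (forall x, (0 <= f x)%R) ->
    measurable_fun setT h -> (forall p, 0 <= h p) ->
    measurable_fun setT (fun lu => \int[lebesgue_measure]_(x in @circ R)
      ((f x)%:E * h (lu, observe x lu))).
  move=> mf f_ge0 mh h_ge0.
  (* The pair [lu] occurs both as an argument of [h] and inside [observe], hence the diagonal. *)
  have mdiag : measurable_fun setT (fun lu : R * R => (lu, lu)).
    by apply: measurable_fun_pair; exact: measurable_id.
  by have := measurableT_comp (measurable_E1_inner _ _ _ _ mf f_ge0 mh h_ge0)
    mdiag; exact.
have fA0 lu x : circ x -> 0 <= (f0 x)%:E * A (observe x lu).
  by move=> cx; rewrite mule_ge0// lee_fin.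
have fB0 lu x : circ x -> 0 <= (f1 x)%:E * B (observe x lu).
  by move=> cx; rewrite mule_ge0// lee_fin.
have iA0 lu :
    0 <= \int[lebesgue_measure]_(x in @circ R) ((f0 x)%:E * A (observe x lu)).
  by apply: integral_ge0 => x; exact: fA0.
have iB0 lu :
    0 <= \int[lebesgue_measure]_(x in @circ R) ((f1 x)%:E * B (observe x lu)).
  by apply: integral_ge0 => x; exact: fB0.
(* The bound is proved for each fixed censoring pair with a constant free of [lu]; integrating over
   the probability [mu] then preserves it, whatever [mu] is. *)
have inner lu : (s * (l - l ^+ 2 * K ^+ n.+1 / 4))%:E <=
    \int[lebesgue_measure]_(x in @circ R) ((f0 x)%:E * A (observe x lu)) +
    l%:E *
    \int[lebesgue_measure]_(x in @circ R) ((f1 x)%:E * B (observe x lu)).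
  have mAx := mx _ _ lu mf0 mA; have mBx := mx _ _ lu mf1 mB.
  rewrite -(ge0_integralZl_EFin lebesgue_measure mcirc (fB0 lu) mBx l0).
  have lfB0 x : circ x -> 0 <= l%:E * ((f1 x)%:E * B (observe x lu)).
    by move=> cx; rewrite mule_ge0 ?fB0.
  have mlBx : measurable_fun (@circ R)
      (fun x => l%:E * ((f1 x)%:E * B (observe x lu))).
    exact: measurable_funeM.
  rewrite -(ge0_integralD lebesgue_measure mcirc (fA0 lu) mAx lfB0 mlBx).
  (* [H] is [f0] times the induction bound at weight [l * (f1 / f0)]. Its integral involves the mass
     of [f1], which is 1, and the second moment of [f1 / f0] under [f0], which is at most [K]. *)
  pose H x : R :=
    ((s * l) * f1 x - (s * (l ^+ 2 * K ^+ n / 4)) * (f1 x ^+ 2 / f0 x))%R.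
  have iH1 : lebesgue_measure.-integrable (@circ R)
      (EFin \o (fun x => (s * l) * f1 x)%R).
    apply: (eq_integrable mcirc _ _ _ (integrableZl mcirc (s * l)%R intf1)).
    move=> x _.
    by rewrite /= EFinM.
  have iH2 : lebesgue_measure.-integrable (@circ R)
      (EFin \o (fun x => (s * (l ^+ 2 * K ^+ n / 4)) * (f1 x ^+ 2 / f0 x))%R).
    apply: (eq_integrable mcirc _ _ _ (integrableZl mcirc
      (s * (l ^+ 2 * K ^+ n / 4))%R intq)) => x _.
    by rewrite /= EFinM.
  have iH : lebesgue_measure.-integrable (@circ R) (EFin \o H).
    by apply: (integrableB mcirc iH1 iH2).
  apply: (@le_trans _ _ (\int[lebesgue_measure]_(x in @circ R) (H x)%:E)).
    rewrite -[leRHS]fineK; last exact: (integrable_fin_num mcirc iH).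
    rewrite lee_fin.
    suff : (s * (l - l ^+ 2 * K ^+ n.+1 / 4) <=
        \int[lebesgue_measure]_(x in @circ R) H x)%R by [].
    rewrite RintegralB//.
    rewrite (RintegralZl _ mcirc intf1) (RintegralZl _ mcirc intq) f1E mulr1.
    have -> : (l ^+ 2 * K ^+ n.+1 / 4 = l ^+ 2 * K ^+ n / 4 * K)%R.
      by rewrite (exprSr K); field.
    rewrite mulrBr lerB// -mulrA ler_wpM2l// ler_wpM2l// divr_ge0//.
    by rewrite mulr_ge0 ?sqr_ge0// exprn_ge0.
  apply: le_integral_ge0r => x cx.
    by apply: adde_ge0; [exact: fA0 | exact: lfB0].
  have f0x := f0_gt0 x.
  (* The weight picks up the likelihood ratio at the uncensored value [x], while [g0] and [g1] see
     only [observe x lu]: censoring cannot help the test. *)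
  have := IH (l * (f1 x / f0 x))%R s
    (fun v => g0 (cons_tuple (observe x lu) v))
    (fun v => g1 (cons_tuple (observe x lu) v)).
  rewrite -/(A (observe x lu)) -/(B (observe x lu)) => IHx.
  have fr0 : (0 <= l * (f1 x / f0 x))%R.
    by rewrite mulr_ge0// divr_ge0.
  have {}IHx := IHx fr0 s0 (measurableT_comp mg0 (mcons _))
    (measurableT_comp mg1 (mcons _)) (fun v => g00 _) (fun v => g10 _) (fun v => sg _).
  have f0x0 : 0 <= (f0 x)%:E by rewrite lee_fin ltW.
  have := lee_wpmul2l f0x0 IHx.
  rewrite ge0_muleDr ?A0//; last by rewrite mule_ge0.
  rewrite [X in _ <= _ + X]muleA -[(f0 x)%:E * (_ * _)%:E]EFinM -EFinM.
  rewrite (_ : f0 x * (l * (f1 x / f0 x)) = l * f1 x)%R; last first.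
    by field; exact: lt0r_neq0.
  rewrite [X in _ <= _ + X * _]EFinM -muleA; congr (_ <= _); congr (_%:E); rewrite /H.
  by field; exact: lt0r_neq0.
have mIA := mlu _ _ mf0 f0_ge0 mA (fun p => A0 p.2).
have mIB := mlu _ _ mf1 f1_ge0 mB (fun p => B0 p.2).
have lB0 lu : 0 <= l%:E *
    \int[lebesgue_measure]_(x in @circ R) ((f1 x)%:E * B (observe x lu)).
  by rewrite mule_ge0.
rewrite /E1 -(ge0_integralZl_EFin mu measurableT (fun lu _ => iB0 lu) mIB l0).
rewrite -(ge0_integralD mu measurableT (fun lu _ => iA0 lu) mIA
  (fun lu _ => lB0 lu)); last exact: measurable_funeM.
apply: (@le_trans _ _ (\int[mu]_lu (s * (l - l ^+ 2 * K ^+ n.+1 / 4))%:E)).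
  rewrite integral_cst// [X in _ <= _ * X](_ : _ = 1) ?mule1//.
  exact: probability_setT.
by apply: le_integral_ge0r => // lu _; rewrite adde_ge0// mule_ge0.
Qed.

End iterated_expectation.

(** * Calculus on the circle *)

Section circle_integrals.
Context (R : realType).
Implicit Types (f F : R -> R).
Local Notation mu := (@lebesgue_measure R).
Local Notation circ := (@circ R).

Lemma integrable_circ_continuous f : continuous f ->
  mu.-integrable circ (EFin \o f).
Proof.
move=> cf.
have : mu.-integrable `[0, 2 * pi]%classic (EFin \o f).
  apply: continuous_compact_integrable; first exact: segment_compact.
  exact: continuous_subspaceT.
apply: integrableS => //; first exact: measurable_circ.
by apply: subset_itvl; rewrite bnd_simp.
Qed.

Lemma Rintegral_circ_FTC f F : continuous f ->
  (forall x : R, is_derive x 1 F (f x)) ->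
  \int[mu]_(x in circ) f x = F (2 * pi) - F 0.
Proof.
move=> cf dF.
have cF : continuous F.
  move=> x; have [dFx _] := dF x.
  exact/differentiable_continuous/derivable1_diffP.
rewrite Rintegral_itv_bndo_bndc; last exact: integrable_circ_continuous.
rewrite /Rintegral (@continuous_FTC2 _ _ F) //.
- by rewrite mulr_gt0// pi_gt0.
- exact: continuous_subspaceT.
- split=> [x _||]; first by have [] := dF x.
  + by apply: cvg_at_right_filter; exact: cF.
  + by apply: cvg_at_left_filter; exact: cF.
- by move=> x _; have [_ dFx] := dF x; rewrite derive1E dFx.
Qed.

Lemma sincos_turn (n : nat) :
  sin (n%:R * (2 * pi)) = 0 :> R /\ cos (n%:R * (2 * pi)) = 1 :> R.
Proof.
have -> : n%:R * (2 * pi) = 0 + (pi *+ 2) *+ n :> R.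
  by rewrite add0r -mulrnA -[in RHS](mulr_natl pi) natrM mulrA [_ * 2]mulrC.
by rewrite (periodicn (@sinD2pi R)) (periodicn (@cosD2pi R)) sin0 cos0.
Qed.

Lemma is_derive_mull (a x : R) : is_derive x 1 (fun y => a * y) a.
Proof.
have := @is_deriveZ R R^o R^o id a x 1 1 (is_derive_id x 1).
by rewrite /GRing.scale/= mulr1.
Qed.

Lemma is_derive_sinZ (a x : R) :
  is_derive x 1 (fun y => sin (a * y)) (a * cos (a * x)).
Proof.
have da := is_derive_mull a x.
have := @is_derive1_comp _ sin (fun y : R => a * y) x _ _ _ da.
by move=> /(_ _ (is_derive_sin _)); rewrite mulrC.
Qed.

Lemma is_derive_cosZ (a x : R) :
  is_derive x 1 (fun y => cos (a * y)) (- (a * sin (a * x))).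
Proof.
have da := is_derive_mull a x.
have := @is_derive1_comp _ cos (fun y : R => a * y) x _ _ _ da.
by move=> /(_ _ (is_derive_cos _)); rewrite mulrC mulrN.
Qed.

Lemma continuous_sinZ (a : R) : continuous (fun x => sin (a * x)).
Proof.
move=> x; have [d _] := is_derive_sinZ a x.
exact/differentiable_continuous/derivable1_diffP.
Qed.

Lemma continuous_cosZ (a : R) : continuous (fun x => cos (a * x)).
Proof.
move=> x; have [d _] := is_derive_cosZ a x.
exact/differentiable_continuous/derivable1_diffP.
Qed.

End circle_integrals.

(** * Orthonormality of the trigonometric basis *)

Section trigonometric_basis.
Context (R : realType).
Implicit Types (f g h : R -> R).
Local Notation mu := (@lebesgue_measure R).
Local Notation circ := (@circ R).

Let mcirc : measurable (circ : set (measurableTypeR R)).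
Proof. exact: measurable_circ. Qed.

Lemma phi_odd k (x : R) : phi k.*2.+1 x = cos (k.+1%:R * x) / Num.sqrt pi.
Proof. by rewrite /phi /= odd_double /= doubleK. Qed.

Lemma phi_even k (x : R) : phi k.*2.+2 x = sin (k.+1%:R * x) / Num.sqrt pi.
Proof. by rewrite /phi /= odd_double /= doubleK. Qed.

(** Case view on the basis index: the constant, then the cosine and the sine of frequency [k + 1].
    It hides the parity test and the halving in [phi]. *)
Variant phi_spec : nat -> Prop :=
  | PhiZero : phi_spec 0
  | PhiOdd k : phi_spec k.*2.+1
  | PhiEven k : phi_spec k.*2.+2.

Lemma phiP j : phi_spec j.
Proof.
case: j => [|j]; first exact: PhiZero.
rewrite -(odd_double_half j); case: (odd j); last exact: PhiOdd.
exact: PhiEven.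
Qed.

Lemma continuous_phi j : continuous (@phi R j).
Proof.
case: (phiP j) => [|k|k] x; first exact: cvg_cst.
  rewrite (_ : phi _ = fun y => cos (k.+1%:R * y) / Num.sqrt pi).
    by apply: cvgM; [exact: continuous_cosZ|exact: cvg_cst].
  by apply/funext => y; rewrite phi_odd.
rewrite (_ : phi _ = fun y => sin (k.+1%:R * y) / Num.sqrt pi).
  by apply: cvgM; [exact: continuous_sinZ|exact: cvg_cst].
by apply/funext => y; rewrite phi_even.
Qed.

Lemma Rintegral_cosZ (a : R) : a != 0 -> sin (a * (2 * pi)) = 0 ->
  \int[mu]_(x in circ) cos (a * x) = 0.
Proof.
move=> a0 sa; apply: (@mulfI _ a) => //.
rewrite -RintegralZl ?mulr0//; last first.
  exact/integrable_circ_continuous/continuous_cosZ.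
have cc : continuous (fun x => a * cos (a * x)).
  by move=> x; apply: cvgM; [exact: cvg_cst|exact: continuous_cosZ].
by rewrite (Rintegral_circ_FTC _ _ _ cc (is_derive_sinZ _ a)) sa mulr0 sin0 subr0.
Qed.

Lemma Rintegral_sinZ (a : R) : cos (a * (2 * pi)) = 1 ->
  \int[mu]_(x in circ) sin (a * x) = 0.
Proof.
(* Frequency zero is included so that the difference of two equal frequencies is covered in the
   cosine-sine products. *)
move=> ca; have [->|a0] := eqVneq a 0.
  rewrite (@eq_Rintegral _ _ _ mu circ (cst 0)) ?Rintegral_cst ?mul0r// => x _.
  by rewrite mul0r sin0.
have Na0 : - a != 0 by rewrite oppr_eq0.
apply: (@mulfI _ (- a)) => //.
rewrite -RintegralZl ?mulr0//; last first.
  exact/integrable_circ_continuous/continuous_sinZ.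
have cs : continuous (fun x => - a * sin (a * x)).
  by move=> x; apply: cvgM; [exact: cvg_cst|exact: continuous_sinZ].
have ds (x : R) : is_derive x 1 (fun y => cos (a * y)) (- a * sin (a * x)).
  by rewrite mulNr; exact: is_derive_cosZ.
by rewrite (Rintegral_circ_FTC _ _ _ cs ds) ca mulr0 cos0 subrr.
Qed.

Lemma Rintegral_phi j : j != 0%N -> \int[mu]_(x in circ) phi j x = 0.
Proof.
case: (phiP j) => [//|k|k] _; have [sn cn] := sincos_turn R k.+1.
  under eq_Rintegral do rewrite phi_odd.
  rewrite RintegralZr ?Rintegral_cosZ ?mul0r//.
  exact/integrable_circ_continuous/continuous_cosZ.
under eq_Rintegral do rewrite phi_even.
rewrite RintegralZr ?Rintegral_sinZ ?mul0r//.
exact/integrable_circ_continuous/continuous_sinZ.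
Qed.

Lemma fine_circ : fine (mu circ) = 2 * pi.
Proof.
by rewrite lebesgue_measure_itv/= lte_fin mulr_gt0 ?pi_gt0// sube0.
Qed.

Lemma Rintegral_circ_cst (c : R) : \int[mu]_(x in circ) c = c * (2 * pi).
Proof. by rewrite Rintegral_cst// fine_circ. Qed.

Lemma RintegralD_circ f g : continuous f -> continuous g ->
  \int[mu]_(x in circ) (f x + g x) =
  \int[mu]_(x in circ) f x + \int[mu]_(x in circ) g x.
Proof.
by move=> cf cg; apply: RintegralD => //; exact: integrable_circ_continuous.
Qed.

Lemma RintegralZl_circ (c : R) f : continuous f ->
  \int[mu]_(x in circ) (c * f x) = c * \int[mu]_(x in circ) f x.
Proof.
by move=> cf; apply: RintegralZl => //; exact: integrable_circ_continuous.
Qed.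

(** Product-to-sum formulas reduce the integral to single sines and cosines over whole turns, where
    only a cosine of frequency zero survives. Cosines alone are paired with the basis, since the
    perturbations use no sines. *)
Lemma phi_orthonormal k j :
  \int[mu]_(x in circ) (phi k.*2.+1 x * phi j x) = (j == k.*2.+1)%:R.
Proof.
have pi0 : (pi : R) != 0 by rewrite lt0r_neq0// pi_gt0.
have sqrtpi : Num.sqrt pi * Num.sqrt pi = pi :> R.
  by rewrite -expr2 sqr_sqrtr// pi_ge0.
have sqrtpi0 : Num.sqrt pi != 0 :> R.
  by apply: contra_neq pi0 => s0; rewrite -sqrtpi s0 mul0r.
have [sk ck] := sincos_turn R k.+1.
case: (phiP j) => [|i|i].
- under eq_Rintegral do rewrite mulrC {1}/phi/=.
  rewrite RintegralZl_circ ?Rintegral_phi ?mulr0//; exact: continuous_phi.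
- have [si ci] := sincos_turn R i.+1.
  have E (x : R) : phi k.*2.+1 x * phi i.*2.+1 x = (2 * pi)^-1 *
      (cos ((k.+1%:R + i.+1%:R) * x) + cos ((k.+1%:R - i.+1%:R) * x)).
    rewrite !phi_odd (mulrDl _ _ x) mulrBl cosB cosD -[in RHS]sqrtpi.
    by field.
  under eq_Rintegral do rewrite E.
  rewrite RintegralZl_circ; last first.
    by move=> x; apply: cvgD; exact: continuous_cosZ.
  rewrite RintegralD_circ; [|exact: continuous_cosZ..].
  rewrite Rintegral_cosZ; last 2 first.
  + by rewrite -natrD pnatr_eq0.
  + by rewrite mulrDl sinD sk si !(mul0r, mulr0) addr0.
  rewrite eqSS -!muln2 eqn_pmul2r// add0r.
  have [->|ik] := eqVneq i k.
    under eq_Rintegral do rewrite subrr mul0r cos0.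
    by rewrite Rintegral_circ_cst mul1r mulVf// mulf_neq0.
  rewrite Rintegral_cosZ ?mulr0//.
  + by rewrite subr_eq0 eqr_nat eqSS eq_sym.
  + by rewrite mulrBl sinB sk si !(mul0r, mulr0) subrr.
- have [si ci] := sincos_turn R i.+1.
  have E (x : R) : phi k.*2.+1 x * phi i.*2.+2 x = (2 * pi)^-1 *
      (sin ((i.+1%:R + k.+1%:R) * x) + sin ((i.+1%:R - k.+1%:R) * x)).
    rewrite phi_odd phi_even (mulrDl _ _ x) mulrBl sinB sinD -[in RHS]sqrtpi.
    by field.
  under eq_Rintegral do rewrite E.
  rewrite RintegralZl_circ; last first.
    by move=> x; apply: cvgD; exact: continuous_sinZ.
  rewrite RintegralD_circ; [|exact: continuous_sinZ..].
  rewrite Rintegral_sinZ; last first.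
    by rewrite mulrDl cosD sk si ck ci !(mul0r, mulr0, mulr1) subr0.
  rewrite Rintegral_sinZ; last first.
    by rewrite mulrBl cosB sk si ck ci !(mul0r, mulr0, mulr1) addr0.
  rewrite addr0 mulr0; case: eqP => // /(congr1 odd).
  by rewrite /= !odd_double.
Qed.

End trigonometric_basis.

(** * Bessel's inequality and cosine perturbations of the uniform density *)

Section trigonometric_densities.
Context (R : realType).
Implicit Types (f g h : R -> R).
Local Notation mu := (@lebesgue_measure R).
Local Notation circ := (@circ R).

Let mcirc : measurable (circ : set (measurableTypeR R)).
Proof. exact: measurable_circ. Qed.

Lemma Rintegral_sum m (F : 'I_m -> R -> R) :
  (forall i, mu.-integrable circ (EFin \o F i)) ->
  \int[mu]_(x in circ) (\sum_(i < m) F i x) =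
  \sum_(i < m) \int[mu]_(x in circ) F i x.
Proof.
move=> iF; rewrite /Rintegral.
under eq_integral do rewrite -sumEFin.
have E i : (\int[mu]_(x in circ) (F i x)%:E =
    (\int[mu]_(x in circ) F i x)%R%:E)%E.
  by rewrite fineK//; exact: (integrable_fin_num mcirc (iF i)).
by rewrite (integral_sum mcirc iF) (eq_bigr _ (fun i _ => E i)) sumEFin.
Qed.

Lemma continuous_sum m (F : 'I_m -> R -> R) :
  (forall i, continuous (F i)) -> continuous (fun x => \sum_(i < m) F i x).
Proof.
move=> cF; elim: (index_enum _) => [|i r IH] x.
  rewrite (_ : (fun _ => _) = cst 0); first exact: cvg_cst.
  by apply/funext => y; rewrite big_nil.
rewrite (_ : (fun _ => _) = fun y => F i y + \sum_(j <- r) F j y).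
  by apply: cvgD; [exact: cF|exact: IH].
by apply/funext => y; rewrite big_cons.
Qed.

Lemma measurable_circ_continuous f : continuous f -> measurable_fun circ f.
Proof. by move=> cf; apply: measurable_funTS; exact: continuous_measurable_fun. Qed.

Lemma integrable_sqr h : measurable_fun circ h ->
  (\int[mu]_(x in circ) (h x ^+ 2)%:E < +oo)%E ->
  mu.-integrable circ (EFin \o (fun x => h x ^+ 2)).
Proof.
move=> mh h2; apply/integrableP; split.
  by apply/measurable_EFinP; exact: measurable_funX.
by under eq_integral do rewrite /= ger0_norm ?sqr_ge0//.
Qed.

(** Domination by [|h f| <= h^2 + f^2], where [f^2] is integrable on [circ] by continuity. *)
Lemma integrable_mul_L2 h f : measurable_fun circ h ->
  (\int[mu]_(x in circ) (h x ^+ 2)%:E < +oo)%E -> continuous f ->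
  mu.-integrable circ (EFin \o (fun x => h x * f x)).
Proof.
move=> mh h2 cf.
have cf2 : continuous (fun x => f x ^+ 2).
  by move=> x; rewrite /= (_ : (fun y => f y ^+ 2) = fun y => f y * f y) //;
    apply: cvgM; exact: cf.
have int2 := integrableD mcirc (integrable_sqr _ mh h2)
  (integrable_circ_continuous _ _ cf2).
apply: (le_integrable mcirc _ _ int2).
  apply/measurable_EFinP; apply: measurable_funM => //.
  exact: measurable_circ_continuous.
move=> x _ /=; rewrite lee_fin normrM [leRHS]ger0_norm ?addr_ge0 ?sqr_ge0//.
rewrite -(real_normK (num_real (h x))) -(real_normK (num_real (f x))).
have := sqr_ge0 (`|h x| - `|f x|); have := normr_ge0 (h x).
have := normr_ge0 (f x); nra.
Qed.

(** With [P] the projection of [h] on the first [m] cosines, both [<h, P>] and [<P, P>] equal the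
    sum of the squared coefficients; expanding the integral of [(h - P)^2 >= 0] concludes. *)
Lemma bessel_circ h m : measurable_fun circ h ->
  (\int[mu]_(x in circ) (h x ^+ 2)%:E < +oo)%E ->
  \sum_(k < m) fcoef h k.*2.+1 ^+ 2 <= \int[mu]_(x in circ) (h x ^+ 2).
Proof.
move=> mh h2; set c := fun k : 'I_m => fcoef h k.*2.+1.
pose P x : R := \sum_(k < m) c k * phi k.*2.+1 x.
have cterm (k : 'I_m) : continuous (fun x : R => c k * phi k.*2.+1 x).
  by move=> x; apply: cvgM; [exact: cvg_cst|exact: continuous_phi].
have cP : continuous P by exact: continuous_sum.
have ih2 := integrable_sqr _ mh h2.
have ihphi j := integrable_mul_L2 _ _ mh h2 (continuous_phi R j).
have ihP := integrable_mul_L2 _ _ mh h2 cP.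
have cPM f : continuous f -> continuous (fun x => P x * f x).
  by move=> cf x; apply: cvgM; [exact: cP|exact: cf].
have iPP := integrable_circ_continuous _ _ (cPM _ cP).
have PphiE (k : 'I_m) : \int[mu]_(x in circ) (P x * phi k.*2.+1 x) = c k.
  under eq_Rintegral do rewrite /P mulr_suml.
  rewrite Rintegral_sum; last first.
    move=> i; apply: integrable_circ_continuous => x.
    by apply: cvgM; [exact: cterm|exact: continuous_phi].
  rewrite (bigD1 k)//= big1 ?addr0 => [|i ik].
    under eq_Rintegral do rewrite -mulrA.
    rewrite RintegralZl_circ ?phi_orthonormal ?eqxx ?mulr1// => x.
    by apply: cvgM; exact: continuous_phi.
  under eq_Rintegral do rewrite -mulrA.
  rewrite RintegralZl_circ ?phi_orthonormal; last first.
    by move=> x; apply: cvgM; exact: continuous_phi.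
  rewrite eqSS -!muln2 eqn_pmul2r// (_ : (k == i :> nat) = false) ?mulr0//.
  by apply/negbTE; rewrite eq_sym.
have hPE : \int[mu]_(x in circ) (h x * P x) = \sum_(k < m) c k ^+ 2.
  under eq_Rintegral do rewrite /P mulr_sumr.
  rewrite Rintegral_sum; last first.
    move=> i; apply: (eq_integrable mcirc _ _ _
      (integrableZl mcirc (c i) (ihphi i.*2.+1))) => x _ /=.
    by rewrite -EFinM mulrCA.
  apply: eq_bigr => k _; under eq_Rintegral do rewrite mulrCA.
  by rewrite RintegralZl.
have PPE : \int[mu]_(x in circ) (P x * P x) = \sum_(k < m) c k ^+ 2.
  under eq_Rintegral do rewrite {2}/P mulr_sumr.
  rewrite Rintegral_sum; last first.
    move=> i; apply: integrable_circ_continuous; exact: cPM.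
  apply: eq_bigr => k _; under eq_Rintegral do rewrite mulrCA.
  by rewrite RintegralZl_circ ?PphiE//; apply: cPM; exact: continuous_phi.
have : 0 <= \int[mu]_(x in circ) (h x - P x) ^+ 2.
  by apply: Rintegral_ge0 => x _; exact: sqr_ge0.
have -> : \int[mu]_(x in circ) (h x - P x) ^+ 2 =
    \int[mu]_(x in circ) ((h x ^+ 2 - 2 * (h x * P x)) + P x * P x).
  by apply: eq_Rintegral => x _; ring.
have i2hP : mu.-integrable circ (EFin \o (fun x => 2 * (h x * P x))).
  apply: (eq_integrable mcirc _ _ _ (integrableZl mcirc 2 ihP)) => x _ /=.
  by rewrite -EFinM.
have iB : mu.-integrable circ
    (EFin \o (fun x => h x ^+ 2 - 2 * (h x * P x))).
  exact: (integrableB mcirc ih2 i2hP).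
rewrite RintegralD// RintegralB// RintegralZl// hPE PPE; lra.
Qed.

Section density.
Variables (m : nat) (c : 'I_m -> R).

(** The perturbing cosines have frequencies [1] to [m] and mean zero, so the total mass stays that
    of the uniform density. *)
Definition trig_density (x : R) : R :=
  (2 * pi)^-1 + \sum_(k < m) c k * phi k.*2.+1 x.

Let cterm (k : 'I_m) : continuous (fun x : R => c k * phi k.*2.+1 x).
Proof. by move=> x; apply: cvgM; [exact: cvg_cst|exact: continuous_phi]. Qed.

Lemma continuous_trig_density : continuous trig_density.
Proof.
by move=> x; apply: cvgD; [exact: cvg_cst|exact: continuous_sum].
Qed.

Lemma Rintegral_trig_density : \int[mu]_(x in circ) trig_density x = 1.
Proof.
rewrite /trig_density RintegralD_circ; last 2 first.
- by move=> x; exact: cvg_cst.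
- exact: continuous_sum.
rewrite Rintegral_circ_cst mulVf ?mulf_neq0 ?lt0r_neq0 ?pi_gt0//.
rewrite Rintegral_sum; last by move=> i; exact: integrable_circ_continuous.
rewrite big1 ?addr0// => i _.
by rewrite RintegralZl_circ ?Rintegral_phi ?mulr0//; exact: continuous_phi.
Qed.

Lemma fcoef_trig_density j : j != 0%N ->
  fcoef trig_density j = \sum_(k < m) c k * (j == k.*2.+1)%:R.
Proof.
move=> j0; rewrite /fcoef /trig_density.
under eq_Rintegral do rewrite mulrDl mulr_suml.
have ck (k : 'I_m) : continuous (fun x : R => c k * phi k.*2.+1 x * phi j x).
  by move=> x; apply: cvgM; [exact: cterm|exact: continuous_phi].
rewrite RintegralD_circ; last 2 first.
- by move=> x; apply: cvgM; [exact: cvg_cst|exact: continuous_phi].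
- exact: continuous_sum.
rewrite RintegralZl_circ ?Rintegral_phi ?mulr0 ?add0r//; last first.
  exact: continuous_phi.
rewrite Rintegral_sum; last by move=> i; exact: integrable_circ_continuous.
apply: eq_bigr => k _; under eq_Rintegral do rewrite -mulrA.
rewrite RintegralZl_circ ?phi_orthonormal// => x.
by apply: cvgM; exact: continuous_phi.
Qed.

Lemma fcoef_trig_density_odd (k : 'I_m) : fcoef trig_density k.*2.+1 = c k.
Proof.
rewrite fcoef_trig_density// (bigD1 k)//= eqxx mulr1 big1 ?addr0// => i ik.
rewrite eqSS -!muln2 eqn_pmul2r// (_ : (k == i :> nat) = false) ?mulr0//.
by apply/negbTE; rewrite eq_sym.
Qed.

(** Bessel's inequality for [h = g - trig_density]. An infinite distance is trivial; otherwise [h]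
    is square integrable and the coefficients of [g] split by linearity. *)
Lemma L2dist2_trig_density_ge g : measurable_fun circ g ->
  ((\sum_(k < m) (fcoef g k.*2.+1 - c k) ^+ 2)%:E <=
   L2dist2 g trig_density)%E.
Proof.
move=> mg; rewrite /L2dist2.
have cd := continuous_trig_density.
pose h x := g x - trig_density x.
have mh : measurable_fun circ h.
  by apply: measurable_funB => //; exact: measurable_circ_continuous.
have [->|] := eqVneq (\int[mu]_(x in circ) ((g x - trig_density x) ^+ 2)%:E)%E
  +oo%E; first by rewrite leey.
rewrite -ltey => h2.
have ih2 := integrable_sqr _ mh h2.
rewrite -[leRHS]fineK; last exact: (integrable_fin_num mcirc ih2).
rewrite lee_fin; apply: le_trans (bessel_circ _ m mh h2).
apply: ler_sum => k _; rewrite -fcoef_trig_density_odd.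
have ihphi := integrable_mul_L2 _ _ mh h2 (continuous_phi R k.*2.+1).
have cdphi : continuous (fun x => trig_density x * phi k.*2.+1 x).
  by move=> x; apply: cvgM; [exact: cd|exact: continuous_phi].
have idphi := integrable_circ_continuous _ _ cdphi.
rewrite (_ : fcoef g _ = fcoef h k.*2.+1 + fcoef trig_density k.*2.+1).
  by rewrite addrK.
rewrite /fcoef -RintegralD//; apply: eq_Rintegral => x _.
by rewrite -mulrDl /h subrK.
Qed.

End density.

End trigonometric_densities.

(** * Positivity and Sobolev norm of the perturbed densities *)

Section hypercube.
Context (R : realType).
Local Notation mu := (@lebesgue_measure R).
Local Notation circ := (@circ R).

Let mcirc : measurable (circ : set (measurableTypeR R)).
Proof. exact: measurable_circ. Qed.

Lemma phi_odd_bound k (x : R) : `|phi k.*2.+1 x| <= (Num.sqrt pi)^-1.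
Proof.
rewrite phi_odd normrM [X in _ * X <= _]ger0_norm; last first.
  by rewrite invr_ge0 sqrtr_ge0.
rewrite -[leRHS]mul1r ler_wpM2r ?invr_ge0 ?sqrtr_ge0// ler_norml.
by rewrite cos_geN1 cos_le1.
Qed.

(** Each cosine is at most [1 / sqrt pi], so the perturbation removes at most half of the uniform
    density [1 / (2 pi)]. *)
Lemma trig_density_ge m (c : 'I_m -> R) (g : R) : (forall k, `|c k| <= g) ->
  g * m%:R / Num.sqrt pi <= (4 * pi)^-1 ->
  forall x, (4 * pi)^-1 <= trig_density R m c x.
Proof.
move=> cg gm x; rewrite /trig_density.
have bnd : `|\sum_(k < m) c k * phi k.*2.+1 x| <= (4 * pi)^-1.
  apply: le_trans (ler_norm_sum _ _ _) _; apply: le_trans gm.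
  apply: (@le_trans _ _ (\sum_(k < m) g / Num.sqrt pi)).
    by apply: ler_sum => k _; rewrite normrM ler_pM ?phi_odd_bound.
  by rewrite sumr_const card_ord -[leLHS]mulr_natr mulrAC.
have -> : (2 * pi)^-1 = 2 * (4 * pi)^-1 :> R.
  by rewrite !invfM mulrA; congr (_ / _); field.
by move: bnd; rewrite ler_norml => /andP[]; lra.
Qed.

Lemma density_L2_trig m (c : 'I_m -> R) :
  (forall x, 0 <= trig_density R m c x) -> density_L2 (trig_density R m c).
Proof.
move=> f0; have cf := continuous_trig_density R m c.
have ci f : continuous f -> (\int[mu]_(x in circ) (f x)%:E =
    (\int[mu]_(x in circ) f x)%R%:E)%E.
  move=> ctf; rewrite fineK//.
  exact: (integrable_fin_num mcirc (integrable_circ_continuous _ _ ctf)).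
split => //.
- exact: measurable_circ_continuous.
- by rewrite ci// Rintegral_trig_density.
- rewrite (ci (fun x => trig_density R m c x ^+ 2)) ?ltry// => x.
  rewrite (_ : (fun y => _) =
    fun y => trig_density R m c y * trig_density R m c y) //.
  by apply: cvgM; exact: cf.
Qed.

Lemma alpha_le (beta : R) (N j : nat) : 0 <= beta -> (j < N)%N ->
  alpha beta j <= N%:R `^ beta.
Proof.
move=> b0 jN; rewrite /alpha; case: ifP => _.
  by rewrite ge0_ler_powR ?nnegrE ?ler_nat.
by rewrite ge0_ler_powR ?nnegrE ?ler_nat// ltnW.
Qed.

(** Only indices below [2 m] contribute to the Sobolev sum, each at most [B = (2 m)^(2 beta) g^2].
    Counting all [2 m] of them is wasteful only by a constant factor. *)
Lemma sobolev_trig (beta Rad g : R) m (c : 'I_m -> R) : 0 < beta ->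
  (forall k, `|c k| <= g) ->
  m.*2%:R `^ (2 * beta) * g ^+ 2 *+ m.*2 < Rad ^+ 2 / pi `^ (2 * beta) ->
  density_L2 (trig_density R m c) -> sobolev beta Rad (trig_density R m c).
Proof.
move=> b0 cg bnd [mf _ _ f2]; do 2!split => //.
set B := m.*2%:R `^ (2 * beta) * g ^+ 2.
have B0 : 0 <= B by rewrite mulr_ge0 ?powR_ge0 ?sqr_ge0.
have term j : alpha beta j ^+ 2 * fcoef (trig_density R m c) j ^+ 2 <=
    if (j < m.*2)%N then B else 0.
  (* The weight at index 0 is [0^beta = 0] as [beta > 0], so the constant part of the density costs
     nothing. *)
  have [->|j0] := eqVneq j 0%N.
    rewrite /alpha/= powR0 ?lt0r_neq0// expr0n/= mul0r.
    by case: ifP.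
  rewrite fcoef_trig_density//; case: ifPn => jm.
    apply: ler_pM; rewrite ?sqr_ge0//.
      rewrite mulrC powRrM powR_mulrn ?powR_ge0// ler_sqr ?nnegrE ?powR_ge0//.
        by apply: alpha_le => //; exact: ltW.
      by rewrite /alpha; case: ifP => _; exact: powR_ge0.
    rewrite -[leLHS]real_normK ?num_real// ler_sqr ?nnegrE ?normr_ge0//.
      case: (phiP j) j0 jm => [//|k|k] _ jm.
      - have km : (k < m)%N by rewrite -ltn_double (leq_trans _ jm).
        rewrite (bigD1 (Ordinal km))//= eqxx mulr1 big1 ?addr0 ?cg// => i ik.
        rewrite eqSS -!muln2 eqn_pmul2r// (_ : (k == i :> nat) = false) ?mulr0//.
        by apply/negbTE; apply: contraNneq ik => E; apply/eqP/val_inj.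
      - have km : (k < m)%N by rewrite -ltn_double 2?ltnW.
        rewrite big1 ?normr0; last first.
          move=> i _; case: eqP => [/(congr1 odd)|]; last by rewrite mulr0.
          by rewrite /= !odd_double.
        by apply: le_trans (cg (Ordinal km)); exact: normr_ge0.
    have m0 : (0 < m)%N by rewrite -double_gt0 (leq_ltn_trans _ jm).
    by apply: le_trans (cg (Ordinal m0)); exact: normr_ge0.
  rewrite big1 ?expr0n ?mulr0// => i _; case: eqP => [E|]; rewrite ?mulr0//.
  by move: jm; rewrite E -doubleS leq_double ltn_ord.
have partial n : \sum_(0 <= j < n) (if (j < m.*2)%N then B else 0) <= B *+ m.*2.
  rewrite (_ : \sum_(0 <= j < n) _ = B *+ minn n m.*2).
    by apply: ler_wpMn2l => //; exact: geq_minr.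
  elim: n => [|n IH]; first by rewrite big_geq// min0n.
  rewrite big_nat_recr//= IH; case: ltnP => nm.
    by rewrite !(minn_idPl _)// ?mulrSr// ltnW.
  by rewrite addr0 !(minn_idPr _)// ltnW.
apply: (@le_lt_trans _ _ (B *+ m.*2)%:E); last by rewrite lte_fin.
apply: lime_le.
  by apply: is_cvg_nneseries => j _ _; rewrite lee_fin mulr_ge0 ?sqr_ge0.
apply: nearW => n; rewrite sumEFin lee_fin; apply: le_trans (partial n).
exact: ler_sum.
Qed.

End hypercube.

(** * Assouad's lemma for censored samples *)

Section assouad.
Context (R : realType).
Local Notation leb := (@lebesgue_measure R).
Local Notation circ := (@circ R).

Let mcirc : measurable (circ : set (measurableTypeR R)).
Proof. exact: measurable_circ. Qed.

(** * Chi-square divergence between densities differing in one coefficient *)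

Section chi_square.
Variables (m : nat) (c c' : 'I_m -> R) (k : 'I_m).
Hypothesis cc' : forall i, i != k -> c' i = c i.
Hypothesis f_ge : forall x, (4 * pi)^-1 <= trig_density R m c x.

Local Notation f := (trig_density R m c).
Local Notation f' := (trig_density R m c').

Let pi4_gt0 : 0 < (4 * pi)^-1 :> R.
Proof. by rewrite invr_gt0 mulr_gt0// pi_gt0. Qed.

Let f_gt0 x : 0 < f x.
Proof. exact: lt_le_trans (f_ge x). Qed.

Lemma trig_density_flip x : f' x = f x + (c' k - c k) * phi k.*2.+1 x.
Proof.
rewrite /trig_density (bigD1 k)//= [in RHS](bigD1 k)//=.
rewrite (eq_bigr (fun i : 'I_m => c i * phi i.*2.+1 x)); last first.
  by move=> i ik; rewrite cc'.
ring.
Qed.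

Lemma integrable_chi_square :
  leb.-integrable circ (EFin \o (fun x => f' x ^+ 2 / f x)).
Proof.
apply: integrable_circ_continuous => x.
have cf := continuous_trig_density R m c; have cf' := continuous_trig_density R m c'.
apply: cvgM.
  rewrite (_ : (fun y => f' y ^+ 2) = fun y => f' y * f' y) //.
  by apply: cvgM; exact: cf'.
by apply: cvgV; [exact: lt0r_neq0|exact: cf].
Qed.

(** With [f' = f + d phi], the integrand is [f + 2 d phi + d^2 phi^2 / f], and [1 / f <= 4 pi]. The
    three terms integrate to 1, 0 and at most [4 pi d^2]. *)
Lemma chi_square_le :
  \int[leb]_(x in circ) (f' x ^+ 2 / f x) <= 1 + 4 * pi * (c' k - c k) ^+ 2.
Proof.
set d := c' k - c k.
pose u x := f x + (2 * d * phi k.*2.+1 x +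
  4 * pi * d ^+ 2 * (phi k.*2.+1 x * phi k.*2.+1 x)).
have cphi := continuous_phi R k.*2.+1.
have cphi2 : continuous (fun x : R => phi k.*2.+1 x * phi k.*2.+1 x).
  by move=> x; apply: cvgM; exact: cphi.
have cZ (a : R) h : continuous h -> continuous (fun x : R => a * h x).
  by move=> ch x; apply: cvgM; [exact: cvg_cst|exact: ch].
have cD (h1 h2 : R -> R) : continuous h1 -> continuous h2 ->
    continuous (fun x => h1 x + h2 x).
  by move=> c1 c2 x; apply: cvgD; [exact: c1|exact: c2].
have cf := continuous_trig_density R m c.
have c1 := cZ (2 * d) _ cphi; have c2 := cZ (4 * pi * d ^+ 2) _ cphi2.
have cu : continuous u by exact: cD cf (cD _ _ c1 c2).
have uE : \int[leb]_(x in circ) u x = 1 + 4 * pi * d ^+ 2.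
  rewrite /u RintegralD_circ//; last exact: cD.
  rewrite Rintegral_trig_density RintegralD_circ// !RintegralZl_circ//.
  by rewrite phi_orthonormal Rintegral_phi// eqxx mulr0 add0r mulr1.
rewrite -uE; apply: le_Rintegral => //.
- exact: integrable_chi_square.
- exact: integrable_circ_continuous.
move=> x _; rewrite trig_density_flip -/d /u; set p := phi _ x.
have fx := f_gt0 x; have fx0 : f x != 0 by exact: lt0r_neq0.
rewrite (_ : (f x + d * p) ^+ 2 / f x = f x + (2 * d * p + (d * p) ^+ 2 / f x)).
  rewrite lerD2l lerD2l (_ : 4 * pi * d ^+ 2 * (p * p) = (d * p) ^+ 2 * (4 * pi)).
    rewrite ler_wpM2l ?sqr_ge0// -[leRHS]invrK lef_pV2 ?posrE ?f_ge//.
  by ring.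
by move: (f x) fx0 => y y0; field.
Qed.

End chi_square.

(** * Averaging the risk over the hypercube *)

Section bayes.
(** Here [a] stands for the normalisation of the risk and [g] for the size of the coefficients. A
    flip moves one coefficient by [2 g], whence [4 pi (2 g)^2 = 16 pi g^2] in [Kn], which keeps the
    second moment of the [n]-sample likelihood ratio below 2. *)
Variables (m n : nat) (g a : R) (mu : probability (R * R)%type R).
Hypothesis g_ge0 : 0 <= g.
Hypothesis a_ge0 : 0 <= a.
Hypothesis gm : g * m%:R / Num.sqrt pi <= (4 * pi)^-1.
Hypothesis Kn : (1 + 16 * pi * g ^+ 2) ^+ n <= 2.

Definition cube_coef (e : {ffun 'I_m -> bool}) (k : 'I_m) : R :=
  (-1) ^+ e k * g.

Local Notation f_ e := (trig_density R m (cube_coef e)).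

Lemma normr_cube_coef e k : `|cube_coef e k| <= g.
Proof. by rewrite normrM normrX normrN1 expr1n mul1r ger0_norm. Qed.

Lemma cube_density_ge e x : (4 * pi)^-1 <= f_ e x.
Proof. exact: trig_density_ge (normr_cube_coef e) gm x. Qed.

Lemma cube_density_gt0 e x : 0 < f_ e x.
Proof.
by apply: lt_le_trans (cube_density_ge e x); rewrite invr_gt0 mulr_gt0// pi_gt0.
Qed.

Definition flip (k : 'I_m) (e : {ffun 'I_m -> bool}) : {ffun 'I_m -> bool} :=
  [ffun i => (i == k) (+) e i].

Lemma flipK k : involutive (flip k).
Proof. by move=> e; apply/ffunP => i; rewrite !ffunE addbA addbb. Qed.

(** The two targets are opposite, of size [g], so the two losses add up to at least [s = 2 a g^2] at
    every sample. Testing with weight [l = 1] keeps a factor [1 - K^n / 4 >= 1/2]. *)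
Lemma coord_testing (fhat : n.-tuple (obs_type R) -> R -> R) e (k : 'I_m) :
  estimator fhat ->
  ((a * g ^+ 2)%:E <=
   En (f_ e) mu (fun s =>
     (a * (fcoef (fhat s) k.*2.+1 - cube_coef e k) ^+ 2)%:E) +
   En (f_ (flip k e)) mu (fun s =>
     (a * (fcoef (fhat s) k.*2.+1 - cube_coef (flip k e) k) ^+ 2)%:E))%E.
Proof.
move=> mfhat.
have flipc : cube_coef (flip k e) k = - cube_coef e k.
  by rewrite /cube_coef ffunE eqxx -mulNr; case: (e k);
    rewrite ?expr0 ?expr1 ?opprK.
have ceg : cube_coef e k ^+ 2 = g ^+ 2 by rewrite exprMn sqrr_sign mul1r.
have mcoef : measurable_fun setT
    (fun s : n.-tuple (obs_type R) => fcoef (fhat s) k.*2.+1).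
  apply: (measurable_Rintegral_circ _ _ _
    (fun p => fhat p.1 p.2 * phi k.*2.+1 p.2)).
  apply: measurable_funM => //; apply: measurableT_comp measurable_snd.
  by apply: continuous_measurable_fun; exact: continuous_phi.
have mg (z : R) : measurable_fun setT (fun s : n.-tuple (obs_type R) =>
    (a * (fcoef (fhat s) k.*2.+1 - z) ^+ 2)%:E).
  apply/measurable_EFinP; apply: measurable_funM => //.
  by apply: measurable_funX; apply: measurable_funB.
have g_0 (z : R) s :
    (0 <= (a * (fcoef (fhat s) k.*2.+1 - z) ^+ 2)%:E)%E.
  by rewrite lee_fin mulr_ge0// sqr_ge0.
have cdiff i : i != k -> cube_coef (flip k e) i = cube_coef e i.
  by move=> ik; rewrite /cube_coef ffunE (negbTE ik).
have mf e' : measurable_fun setT (f_ e').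
  by apply: continuous_measurable_fun; exact: continuous_trig_density.
have chi : \int[leb]_(x in circ) (f_ (flip k e) x ^+ 2 / f_ e x) <=
    1 + 16 * pi * g ^+ 2.
  apply: le_trans (chi_square_le _ _ _ _ cdiff (cube_density_ge e)) _.
  rewrite flipc (_ : (- cube_coef e k - cube_coef e k) ^+ 2 = 4 * g ^+ 2).
    by rewrite (_ : 4 * pi * (4 * g ^+ 2) = 16 * pi * g ^+ 2)//; ring.
  by rewrite -ceg; ring.
have K0 : 0 <= 1 + 16 * pi * g ^+ 2.
  by rewrite addr_ge0// mulr_ge0 ?sqr_ge0// mulr_ge0// pi_ge0.
have s0 : 0 <= 2 * (a * g ^+ 2) by rewrite !mulr_ge0 ?sqr_ge0.
have := two_point_testing R mu (f_ e) (f_ (flip k e)) _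
  (mf e) (mf (flip k e)) (cube_density_gt0 e)
  (fun x => ltW (cube_density_gt0 (flip k e) x))
  (integrable_circ_continuous _ _ (continuous_trig_density _ _ _))
  (Rintegral_trig_density _ _ _)
  (integrable_chi_square _ _ _ (cube_density_ge e)) chi K0
  n 1 _ _ _ ler01 s0 (mg (cube_coef e k)) (mg (cube_coef (flip k e) k))
  (g_0 _) (g_0 _).
rewrite mul1e => H; apply: le_trans (H _) => [|s].
  rewrite lee_fin expr1n mul1r.
  have := mulr_ge0 a_ge0 (sqr_ge0 g); set S := a * _ => S0.
  have X2 : 0 <= 2 - (1 + 16 * pi * g ^+ 2) ^+ n by rewrite subr_ge0.
  move: X2; set X := (_ + _) ^+ n => X2; have := mulr_ge0 S0 X2; lra.
rewrite -EFinD lee_fin flipc -ceg.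
set y := fcoef _ _; set z := cube_coef _ _.
have : 0 <= a * y ^+ 2 by rewrite mulr_ge0 ?sqr_ge0.
nra.
Qed.

(** Averaging over all sign vectors: by [coord_testing], each coordinate contributes at least
    [a g^2 / 2] on average, while for every [e] the coordinate risks sum to at most [V]. *)
Lemma assouad (fhat : n.-tuple (obs_type R) -> R -> R) (V : \bar R) :
  estimator fhat ->
  (forall e, (En (f_ e) mu (fun s => a%:E * L2dist2 (fhat s) (f_ e)) <= V)%E) ->
  ((a * g ^+ 2 * m%:R / 2)%:E <= V)%E.
Proof.
move=> mfhat riskV.
pose T e (k : 'I_m) := En (f_ e) mu (fun s =>
  (a * (fcoef (fhat s) k.*2.+1 - cube_coef e k) ^+ 2)%:E).
have f0 e x : circ x -> 0 <= f_ e x by move=> _; exact/ltW/cube_density_gt0.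
have L0 e s : (0 <= L2dist2 (fhat s) (f_ e))%E.
  by apply: integral_ge0 => x _; rewrite lee_fin sqr_ge0.
have g_0 e (k : 'I_m) s :
    (0 <= (a * (fcoef (fhat s) k.*2.+1 - cube_coef e k) ^+ 2)%:E)%E.
  by rewrite lee_fin mulr_ge0// sqr_ge0.
have T0 e k : (0 <= T e k)%E.
  by apply: En_ge0 => [x|s]; [exact: f0|exact: g_0].
have TV e : (\sum_(k < m) T e k <= V)%E.
  apply: le_trans (riskV e).
  apply: (le_trans (En_sum_ge _ _ _ _ _ _ _ (f0 e) (g_0 e))).
  apply: (le_En _ _ _ _ _ _ (f0 e)) => s; first by rewrite mule_ge0.
  rewrite sumEFin -mulr_sumr EFinM lee_wpmul2l//.
  apply: L2dist2_trig_density_ge; apply: measurable_funTS.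
  exact: (measurable_fun_pair2 s mfhat).
have [->|Vy] := eqVneq V +oo%E; first by rewrite leey.
have TkV e k : (T e k <= V)%E.
  by apply: le_trans (TV e); rewrite (bigD1 k)//= leeDl// sume_ge0.
have e0 : {ffun 'I_m -> bool} := [ffun=> false].
have V0 : (0 <= V)%E by apply: le_trans (TV e0); exact: sume_ge0.
have Vfin : V \is a fin_num by rewrite ge0_fin_numE// ltey.
have Tfin e k : T e k \is a fin_num.
  by rewrite ge0_fin_numE// (le_lt_trans (TkV e k))// ltey.
pose t e k := fine (T e k); pose v := fine V.
have tv e : \sum_(k < m) t e k <= v.
  rewrite -lee_fin -sumEFin fineK//; apply: le_trans (TV e).
  by apply: lee_sum => k _; rewrite fineK.
have pair e k : a * g ^+ 2 <= t e k + t (flip k e) k.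
  by rewrite -lee_fin EFinD !fineK//; exact: coord_testing.
rewrite -(fineK Vfin) lee_fin -/v.
pose N := #|{ffun 'I_m -> bool}|.
have N0 : 0 < N%:R :> R by rewrite ltr0n; apply/card_gt0P; exists e0.
have upper : \sum_e \sum_(k < m) t e k <= N%:R * v.
  apply: (@le_trans _ _ (\sum_(e : {ffun 'I_m -> bool}) v)).
    by apply: ler_sum => e _; exact: tv.
  by rewrite sumr_const mulr_natl.
have lower k : N%:R * (a * g ^+ 2) <= 2 * \sum_e t e k.
  (* The involution [flip k] permutes the cube, so twice the sum over [e] is a sum over neighbouring
     pairs. *)
  have E : \sum_e t e k = \sum_e t (flip k e) k.
    by rewrite (reindex_inj (inv_inj (flipK k))).
  apply: (@le_trans _ _ (\sum_(e : {ffun 'I_m -> bool}) a * g ^+ 2)).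
    by rewrite sumr_const mulr_natl.
  rewrite [leRHS]mulr_natl mulr2n {2}E -big_split/=.
  by apply: ler_sum => e _; exact: pair.
have : m%:R * (N%:R * (a * g ^+ 2)) <= 2 * (N%:R * v).
  apply: (@le_trans _ _ (\sum_(k < m) 2 * \sum_e t e k)).
    rewrite (_ : m%:R * _ = \sum_(k < m) N%:R * (a * g ^+ 2)); last first.
      by rewrite sumr_const card_ord mulr_natl.
    by apply: ler_sum => k _; exact: lower.
  by rewrite -mulr_sumr exchange_big ler_wpM2l.
have -> : m%:R * (N%:R * (a * g ^+ 2)) = N%:R * (m%:R * (a * g ^+ 2)) by ring.
have -> : 2 * (N%:R * v) = N%:R * (2 * v) by ring.
rewrite ler_pM2l// => H; rewrite ler_pdivrMr//.
by rewrite [v * 2]mulrC [a * _ * _]mulrC.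
Qed.

End bayes.

End assouad.

(** * From the hypercube to the minimax risk *)

Section minimax.
Context (R : realType).

Lemma limn_einf_ge (u : (\bar R)^nat) (c : \bar R) N :
  (forall n, (N <= n)%N -> (c <= u n)%E) -> (c <= limn_einf u)%E.
Proof.
move=> cu; rewrite limn_einf_lim; apply: lime_ge; first exact: is_cvg_einfs.
exists N => // n /= Nn; apply: le_ereal_inf_tmp => _ [k /= nk <-].
exact/cu/(leq_trans Nn).
Qed.

Lemma minimax_risk_ge (beta Rad g : R) (mu : probability (R * R)%type R) m n :
  0 < beta -> 0 <= g -> g * m%:R / Num.sqrt pi <= (4 * pi)^-1 ->
  (1 + 16 * pi * g ^+ 2) ^+ n <= 2 ->
  m.*2%:R `^ (2 * beta) * g ^+ 2 *+ m.*2 < Rad ^+ 2 / pi `^ (2 * beta) ->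
  ((n%:R `^ (2 * beta / (2 * beta + 1)) * g ^+ 2 * m%:R / 2)%:E <=
   minimax_risk beta Rad mu n)%E.
Proof.
move=> b0 g0 gm Kn bnd; apply: le_ereal_inf_tmp => _ [fhat mfhat <-].
apply: (@assouad R m n g _ mu g0 (powR_ge0 _ _) gm Kn _ _ mfhat) => e.
apply: ereal_sup_ubound; exists (trig_density R m (cube_coef R m g e)) => //.
have dens : density_L2 (trig_density R m (cube_coef R m g e)).
  by apply: density_L2_trig => x; apply/ltW/cube_density_gt0.
by split => //; apply: (sobolev_trig _ _ _ g) => //; exact: normr_cube_coef.
Qed.

End minimax.

(** * Choice of the constants and the rate *)

Theorem theorem1 (R : realType) (beta Rad : R) :
  1 / 2 <= beta -> 0 < Rad ->
  exists c : R, 0 < c /\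
    forall mu : probability (R * R)%type R, censoring_law mu ->
      (c%:E <= limn_einf (fun n => minimax_risk beta Rad mu n))%E.
Proof.
move=> b12 Rad0.
have b0 : 0 < beta by lra.
have pi0 : 0 < pi :> R by exact: pi_gt0.
pose B := Rad ^+ 2 / pi `^ (2 * beta).
have B0 : 0 < B by rewrite divr_gt0 ?exprn_gt0 ?powR_gt0.
(* Since [m <= p] and [p^(2 beta + 1) = n], the Sobolev sum is at most
   [(2 m)^(2 beta + 1) kappa / n <= D kappa]. *)
pose D : R := 2 `^ (2 * beta + 1).
have D0 : 0 < D by rewrite powR_gt0.
have ln20 : 0 < ln 2 :> R by rewrite ln_gt0// ltr1n.
(* The first bound gives [(1 + 16 pi kappa / n)^n <= exp(16 pi kappa) <= 2]; the second keeps the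
   Sobolev sum at most [B / 2], hence strictly inside the class. Neither involves [mu] or [n]. *)
pose kappa := Num.min (ln 2 / (16 * pi)) (B / D / 2).
have k0 : 0 < kappa.
  rewrite lt_min; apply/andP; split; first by apply: divr_gt0 => //; exact: mulr_gt0.
  by apply: divr_gt0 => //; exact: divr_gt0.
have k1 : kappa <= ln 2 / (16 * pi) by rewrite ge_min lexx.
have k2 : kappa <= B / D / 2 by rewrite ge_min lexx orbT.
exists (kappa / 4); split; first by rewrite divr_gt0.
move=> mu _; apply: (limn_einf_ge _ _ _ 1%N) => n n1.
have n0 : 0 < n%:R :> R by rewrite ltr0n.
have n1R : 1 <= n%:R :> R by rewrite ler1n.
(* The optimal number of frequencies before rounding; [n >= 1] gives [p >= 1], so its integer part
   [m] is positive. *)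
pose p : R := n%:R `^ (2 * beta + 1)^-1.
have b21 : 2 * beta + 1 != 0 by rewrite lt0r_neq0//; lra.
have p1 : 1 <= p.
  rewrite -(powRr0 n%:R) ler_powR// invr_ge0; lra.
have p0 : 0 <= p by exact: le_trans ler01 p1.
pose m := Num.trunc p.
have /andP[mp pm] := truncn_itv p0.
have m1 : 1 <= m%:R :> R by rewrite ler1n truncn_gt0.
have pE : p `^ (2 * beta + 1) = n%:R by rewrite -powRrM mulVf// powRr1// ltW.
(* From [beta >= 1/2] the exponent [2 / (2 beta + 1)] is at most 1. This keeps [g m] bounded. *)
have p2n : p ^+ 2 <= n%:R.
  rewrite -(powR_mulrn 2 p0) -powRrM -[leRHS](powRr1 (ltW n0)) ler_powR//.
  rewrite ler_pdivrMl; last by lra.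
  lra.
pose g := Num.sqrt (kappa / n%:R).
have g2 : g ^+ 2 = kappa / n%:R by rewrite sqr_sqrtr// divr_ge0 ?ltW.
have g0 : 0 <= g by exact: sqrtr_ge0.
(* Here [ln 2 <= 1], because [2 = 1 + 1 <= exp 1]. *)
have k3 : kappa <= (16 * pi)^-1.
  apply: (le_trans k1); apply: ler_piMl.
    by rewrite invr_ge0 mulr_ge0// ltW.
  rewrite -ler_expR lnK ?posrE//; apply: le_trans (expR_ge1Dx 1).
  by rewrite -[leLHS]natr1.
(* After squaring, [g^2 m^2 = kappa m^2 / n <= kappa <= 1 / (16 pi)], which is [(4 pi)^(-2) pi]. *)
have gm : g * m%:R / Num.sqrt pi <= (4 * pi)^-1.
  have sp0 : 0 < Num.sqrt pi :> R by rewrite sqrtr_gt0.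
  have spE : Num.sqrt pi ^+ 2 = pi :> R by rewrite sqr_sqrtr// ltW.
  rewrite ler_pdivrMr// -ler_sqr ?nnegrE; last 2 first.
  - by rewrite mulr_ge0.
  - by rewrite ltW// mulr_gt0// invr_gt0 mulr_gt0.
  rewrite !exprMn g2 exprVn exprMn spE.
  apply: (@le_trans _ _ kappa).
    rewrite mulrAC ler_pdivrMr// ler_wpM2l ?(ltW k0)//.
    by apply: le_trans p2n; rewrite ler_sqr ?nnegrE.
  apply: (le_trans k3); move: (pi) pi0 => q q0.
  by rewrite le_eqVlt; apply/orP; left; apply/eqP; field; rewrite lt0r_neq0.
have Kn : (1 + 16 * pi * g ^+ 2) ^+ n <= 2.
  apply: (@le_trans _ _ (expR (16 * pi * g ^+ 2) ^+ n)).
    rewrite lerXn2r ?nnegrE ?expR_ge0 ?expR_ge1Dx//.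
    by rewrite addr_ge0// mulr_ge0 ?sqr_ge0// mulr_ge0// ltW.
  rewrite -expRM_natl -[leRHS]lnK ?posrE// ler_expR g2.
  rewrite (_ : n%:R * _ = kappa * (16 * pi)).
    by rewrite -ler_pdivlMr// mulr_gt0.
  by rewrite mulrCA [n%:R * (_ / _)]mulrC divfK ?lt0r_neq0// mulrC.
have bnd : m.*2%:R `^ (2 * beta) * g ^+ 2 *+ m.*2 < B.
  have m20 : 0 <= m.*2%:R :> R by rewrite ler0n.
  have m2p : m.*2%:R <= 2 * p :> R.
    by rewrite -mul2n natrM ler_wpM2l.
  apply: (@le_lt_trans _ _ (D * kappa)).
    rewrite -[leLHS]mulr_natr mulrAC.
    rewrite (_ : _ `^ _ * _ = m.*2%:R `^ (2 * beta + 1)); last first.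
      rewrite powRD ?powRr1//; apply/implyP => _.
      by rewrite pnatr_eq0 -lt0n double_gt0 -(ltr_nat R) (lt_le_trans _ m1).
    apply: (@le_trans _ _ ((2 * p) `^ (2 * beta + 1) * g ^+ 2)).
      rewrite ler_wpM2r ?sqr_ge0// ge0_ler_powR ?nnegrE ?mulr_ge0//; lra.
    rewrite powRM// pE g2 -mulrA ler_wpM2l ?(ltW D0)//.
    by rewrite mulrCA divff ?mulr1// lt0r_neq0.
  rewrite mulrC -ltr_pdivlMr//; apply: (le_lt_trans k2).
  by have := divr_gt0 B0 D0; move: (B / D) => q; lra.
apply: le_trans (minimax_risk_ge _ _ _ _ mu _ _ b0 g0 gm Kn bnd).
rewrite lee_fin g2; set a := _ `^ _.
(* The exponents [2 beta / (2 beta + 1)] and [1 / (2 beta + 1)] add up to 1. The bound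
   [kappa / 2 * (a m / n)] is thus [kappa / 2 * (m / p)]. *)
have aE : a * p = n%:R.
  rewrite -powRD; last by rewrite lt0r_neq0// implybT.
  by rewrite -[X in _ + X]mul1r -mulrDl divff// powRr1// ltW.
have a0 : 0 <= a by exact: powR_ge0.
have -> : a * (kappa / n%:R) * m%:R / 2 = kappa / 2 * (a * m%:R / n%:R).
  by field; rewrite lt0r_neq0.
rewrite (_ : kappa / 4 = kappa / 2 * (1 / 2)); last by field.
rewrite ler_pM2l ?divr_gt0// ler_pdivlMr// -aE.
(* Rounding loses at most a factor 2, since [p < m + 1 <= 2 m]; this yields the constant
   [kappa / 4]. *)
have : p <= 2 * m%:R by move: pm; rewrite -natr1 => /ltW pm; apply: (le_trans pm); lra.
move=> /(ler_wpM2l a0); lra.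
Qed.
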